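(* The set $\mathsf{Th}^{\mathsf{H10}}(\mathcal{T}(\mathcal{L}_{\mathsf{BT}}))$ of all sentences of the form $\exists\vec{x}\,[\,s=t\,]$, with $s,t$ terms of the language $\mathcal{L}_{\mathsf{BT}}=\{\perp,\langle\cdot,\cdot\rangle,\cdot[\cdot\mapsto\cdot]\}$, that are true in $\mathcal{T}(\mathcal{L}_{\mathsf{BT}})$ is undecidable.
   Context: Let $\mathbf{H}$ be the set of variable-free terms built from a constant $\perp$ and a binary function symbol $\langle\cdot,\cdot\rangle$. The substitution $t[r\mapsto s]$ is the term obtained by replacing each occurrence of $r$ in $t$ by $s$ (formally: $s$ if $t=r$; $\perp$ if $t\ne r$, $t=\perp$; $\langle t_1[r\mapsto s],t_2[r\mapsto s]\rangle$ if $t\ne r$, $t=\langle t_1,t_2\rangle$). $\mathcal{T}(\mathcal{L}_{\mathsf{BT}})=(\mathbf{H},\perp,\langle\cdot,\cdot\rangle,\cdot[\cdot\mapsto\cdot])$, with $\perp,\langle\cdot,\cdot\rangle$ interpreted as themselves. *)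

(* Defs.v *)
From HB Require Import structures.
From mathcomp Require Import all_boot.
From Stdlib Require Cantor.

Set Implicit Arguments.
Unset Strict Implicit.
Unset Printing Implicit Defensive.

Inductive tree : Type :=
| Leaf
| Node (t1 t2 : tree).

Fixpoint tree_eqb (t u : tree) : bool :=
  match t, u with
  | Leaf, Leaf => true
  | Node t1 t2, Node u1 u2 => tree_eqb t1 u1 && tree_eqb t2 u2
  | _, _ => false
  end.

Lemma tree_eqP : Equality.axiom tree_eqb.
Proof.
elim=> [|t1 IH1 t2 IH2] [|u1 u2] /=; try by constructor.
apply: (iffP andP) => [[/IH1-> /IH2->] // | [<- <-]].
by split; [apply/IH1 | apply/IH2].
Qed.

HB.instance Definition _ := hasDecEq.Build tree tree_eqP.

(* [tree_subst t r s] is t[r |-> s]: replaced occurrences are not revisited. *)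
Fixpoint tree_subst (t r s : tree) : tree :=
  if t == r then s else
  match t with
  | Leaf => Leaf
  | Node t1 t2 => Node (tree_subst t1 r s) (tree_subst t2 r s)
  end.

Inductive term : Type :=
| Var (x : nat)
| Bot
| Pair (s t : term)
| Subst (t r s : term).

(* Only equations under a (possibly empty) block of existential quantifiers. *)
Inductive formula : Type :=
| Eq (s t : term)
| Ex (x : nat) (phi : formula).

Fixpoint term_vars (t : term) : seq nat :=
  match t with
  | Var x => [:: x]
  | Bot => [::]
  | Pair s t => term_vars s ++ term_vars t
  | Subst t r s => term_vars t ++ term_vars r ++ term_vars s
  end.

Fixpoint free_vars (phi : formula) : seq nat :=
  match phi with
  | Eq s t => term_vars s ++ term_vars t
  | Ex x psi => [seq y <- free_vars psi | y != x]
  end.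

Definition is_sentence (phi : formula) : Prop := free_vars phi = [::].

Fixpoint eval (rho : nat -> tree) (t : term) : tree :=
  match t with
  | Var x => rho x
  | Bot => Leaf
  | Pair s t => Node (eval rho s) (eval rho t)
  | Subst t r s => tree_subst (eval rho t) (eval rho r) (eval rho s)
  end.

Fixpoint sat (rho : nat -> tree) (phi : formula) : Prop :=
  match phi with
  | Eq s t => eval rho s = eval rho t
  | Ex x psi => exists a : tree, sat [eta rho with x |-> a] psi
  end.

Definition Th_H10 (phi : formula) : Prop :=
  is_sentence phi /\ forall rho, sat rho phi.

Definition pcode (a b : nat) : nat := Cantor.to_nat (a, b).
Arguments pcode : simpl never.

Lemma pcode_inj a b c d : pcode a b = pcode c d -> a = c /\ b = d.
Proof. by move/Cantor.to_nat_inj => [-> ->]. Qed.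

Fixpoint term_code (t : term) : nat :=
  match t with
  | Var x => pcode 0 x
  | Bot => pcode 1 0
  | Pair s t => pcode 2 (pcode (term_code s) (term_code t))
  | Subst t r s =>
      pcode 3 (pcode (term_code t) (pcode (term_code r) (term_code s)))
  end.

Fixpoint formula_code (phi : formula) : nat :=
  match phi with
  | Eq s t => pcode 0 (pcode (term_code s) (term_code t))
  | Ex x psi => pcode 1 (pcode x (formula_code psi))
  end.

Lemma term_code_inj : injective term_code.
Proof.
elim=> [x||s1 IH1 s2 IH2|t1 IH1 t2 IH2 t3 IH3] [y||u1 u2|u1 u2 u3] /=;
  move=> /pcode_inj[] // _.
- by move->.
- by move=> /pcode_inj[/IH1-> /IH2->].
- by move=> /pcode_inj[/IH1-> /pcode_inj[/IH2-> /IH3->]].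
Qed.

Lemma formula_code_inj : injective formula_code.
Proof.
elim=> [s t|x phi IH] [u v|y psi] /= /pcode_inj[] // _.
- by move=> /pcode_inj[/term_code_inj-> /term_code_inj->].
- by move=> /pcode_inj[-> /IH->].
Qed.

Inductive recfun : nat -> Type :=
| RZero n : recfun n
| RSucc : recfun 1
| RProj n (i : 'I_n) : recfun n
| RComp k n (f : recfun k) (g : 'I_k -> recfun n) : recfun n
| RPrec n (f : recfun n) (g : recfun n.+2) : recfun n.+1
| RMu n (f : recfun n.+1) : recfun n.

(* The graph of h(0, v) = f(v), h(x+1, v) = g(x, h(x, v), v). *)
Fixpoint prec_graph n (F : n.-tuple nat -> nat -> Prop)
    (G : n.+2.-tuple nat -> nat -> Prop)
    (x : nat) (v : n.-tuple nat) (y : nat) : Prop :=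
  match x with
  | 0 => F v y
  | x'.+1 => exists2 z, prec_graph F G x' v z & G [tuple of x' :: z :: v] y
  end.

(* [computes f v y]: f is defined at v, with value y. In the [RMu] case, f must
   be defined (and nonzero) at all arguments below the least zero. *)
Fixpoint computes n (f : recfun n) : n.-tuple nat -> nat -> Prop :=
  match f in recfun n return n.-tuple nat -> nat -> Prop with
  | RZero _ => fun _ y => y = 0
  | RSucc => fun v y => y = (thead v).+1
  | RProj _ i => fun v y => y = tnth v i
  | RComp k _ f g => fun v y =>
      exists2 w : k.-tuple nat,
        forall i, computes (g i) v (tnth w i) & computes f w y
  | RPrec _ f g => fun v y =>
      prec_graph (computes f) (computes g) (thead v) [tuple of behead v] y
  | RMu _ f => fun v y =>
      computes f [tuple of y :: v] 0 /\
      forall z, z < y -> exists u, computes f [tuple of z :: v] u.+1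
  end.

(* A set of natural numbers is decidable when its characteristic function is
   recursive, and a set of formulas when its set of Goedel numbers is. *)
Definition decidable_nat_set (A : nat -> Prop) : Prop :=
  exists2 chi : nat -> bool,
    forall m, A m <-> chi m &
    exists f : recfun 1, forall m, computes f [tuple m] (chi m).

Definition decidable_formula_set (S : formula -> Prop) : Prop :=
  decidable_nat_set (fun m => exists2 phi, S phi & formula_code phi = m).

(* Main.v *)
Require Import Defs.
From HB Require Import structures.
From mathcomp Require Import all_boot zify.
From Stdlib Require Import FunctionalExtensionality.

Set Implicit Arguments.
Unset Strict Implicit.
Unset Printing Implicit Defensive.

(* A recursive function is computed by a counter machine, whose halting runs
   are tilings. A configuration is a row of columns, each holding one bit per
   register: the content of a register is the number of columns where its bit
   is set, so that an increment changes a single column. Writing the rows one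
   after the other yields one word Z of Wang tiles, and Z is a halting run
   exactly when its letter-by-letter images satisfy
     top(Z) qf u = q0 input bot(Z)    and    d right(Z) = left(Z) d.
   The first equation matches each row with the next one, because it shifts Z
   by the length of a row; the second one matches neighbours within a row.
   Both can be written with substitution: a word is a right comb of letters,
   where letters and the end marker are distinct trees of equal size, so a
   letter-by-letter image is a sequence of substitutions of letters, and
   concatenation is a substitution for the end marker. Hence halting is
   expressed by a single equation, and the numeral of a code can be plugged
   into it by a recursive function; a decision procedure is refuted by
   diagonalization. *)

(** * Words as trees *)

Fixpoint nodes (t : tree) : nat :=
  if t is Node t1 t2 then (nodes t1 + nodes t2).+1 else 0.

Lemma Node_inj t1 t2 u1 u2 : Node t1 t2 = Node u1 u2 -> t1 = u1 /\ t2 = u2.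
Proof. by case. Qed.

Lemma subst_below r s t : nodes t < nodes r -> tree_subst t r s = t.
Proof.
elim: t => [|t1 IH1 t2 IH2] /= lt_tr; case: eqP => [E|_] //.
- by rewrite -E in lt_tr.
- by move: lt_tr; rewrite -E /= ltnn.
by rewrite IH1 ?IH2 //; lia.
Qed.

(** An occurrence of [r] strictly inside [t] leaves a copy of [s] strictly inside the result, which
    is then larger than [s]. This is what allows a substitution to be inverted on trees not yet
    known to be words. *)
Lemma subst_small_inv r s t :
  nodes (tree_subst t r s) <= nodes s -> t = r \/ tree_subst t r s = t.
Proof.
elim: t => [|t1 IH1 t2 IH2] /=; case: eqP => [->|_]; try by [left|right].
move=> /= le_s; right.
have [E|->] := IH1 ltac:(lia).
  move: le_s; rewrite E; case: (r) => [|a b] /=; rewrite ?eqxx; lia.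
have [E|->] := IH2 ltac:(lia) => //.
move: le_s; rewrite E; case: (r) => [|a b] /=; rewrite ?eqxx; lia.
Qed.

Lemma subst_Node t1 t2 r s : Node t1 t2 <> r ->
  tree_subst (Node t1 t2) r s = Node (tree_subst t1 r s) (tree_subst t2 r s).
Proof. by rewrite /= -/(Node t1 t2) => /eqP/negPf ->. Qed.

Fixpoint left_comb (n : nat) : tree :=
  if n is m.+1 then Node (left_comb m) Leaf else Leaf.

Lemma nodes_left_comb n : nodes (left_comb n) = n.
Proof. by elim: n => //= n ->; rewrite addn0. Qed.

Section Words.
Variable A : finType.

(* All letters, and the end marker [None], have the same number of nodes, so
   none of them is a proper subtree of another one. *)
Definition letter (a : option A) : tree :=
  Node (left_comb (enum_rank a)) (left_comb (#|{: option A}| - enum_rank a)).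

Definition letter_size := #|{: option A}|.+1.

Lemma nodes_letter a : nodes (letter a) = letter_size.
Proof.
by rewrite /= !nodes_left_comb subnKC // ltnW.
Qed.

Lemma letter_inj : injective letter.
Proof.
move=> a b [/(congr1 nodes)]; rewrite !nodes_left_comb => E _.
by apply/enum_rank_inj/val_inj.
Qed.

Definition letter_eq a b : (letter a == letter b) = (a == b) := inj_eq letter_inj a b.

Definition word (w : seq A) (t : tree) : tree :=
  foldr (fun a => Node (letter (Some a))) t w.

Definition eword (w : seq A) : tree := word w (letter None).

Lemma subst_letter a b s :
  tree_subst (letter a) (letter b) s = if a == b then s else letter a.
Proof.
rewrite /= -/(letter a) letter_eq; case: eqP => // _.
by rewrite !subst_below // nodes_letter nodes_left_comb /letter_size ?ltnS ?leq_subr // ltnW.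
Qed.

Lemma Node_neq_letter x t b : letter_size <= nodes t -> Node x t <> letter b.
Proof.
move=> le_t /(congr1 nodes); rewrite nodes_letter /=; lia.
Qed.

Lemma letter_Node_inv a b t : Node (letter a) t = letter b -> False.
Proof.
move/(congr1 nodes); rewrite nodes_letter /= -/(nodes (letter a)).
by have /= := nodes_letter a; lia.
Qed.

Lemma nodes_word w t : letter_size <= nodes t -> letter_size <= nodes (word w t).
Proof. by elim: w => //= a w IH /IH; lia. Qed.

Lemma nodes_eword w : letter_size <= nodes (eword w).
Proof. by apply: nodes_word; rewrite nodes_letter. Qed.

Lemma word_cat w v t : word (w ++ v) t = word w (word v t).
Proof. exact: foldr_cat. Qed.

Lemma word_cons a w t : Node (letter (Some a)) (word w t) = word (a :: w) t.
Proof. by []. Qed.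

Lemma subst_end w s : tree_subst (eword w) (letter None) s = word w s.
Proof.
elim: w => [|a w IH]; first by rewrite subst_letter eqxx.
rewrite [eword _]/= -/(eword w) subst_Node; last exact/Node_neq_letter/nodes_eword.
by rewrite IH subst_letter.
Qed.

Lemma subst_word w a b :
  tree_subst (eword w) (letter (Some a)) (letter (Some b)) =
  eword [seq if x == a then b else x | x <- w].
Proof.
elim: w => [|x w IH]; first by rewrite subst_letter.
rewrite [eword _]/= -/(eword w) subst_Node; last exact/Node_neq_letter/nodes_eword.
rewrite IH subst_letter [in RHS]/= (inj_eq Some_inj) /eword /=.
by case: eqP.
Qed.

Lemma eword_inj : injective eword.
Proof.
elim=> [|a w IH] [|b v] //.
- by move/esym/letter_Node_inv.
- by move/letter_Node_inv.
by move=> /Node_inj[/letter_inj[->] /IH ->].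
Qed.

Lemma word_eword_inv w t v :
  word w t = eword v -> exists2 v', t = eword v' & v = w ++ v'.
Proof.
elim: w v => [|a w IH] v; first by exists v.
case: v => [/letter_Node_inv //|b v] /Node_inj[/letter_inj[<-] /IH[v' -> ->]].
by exists v'.
Qed.

(** For words, this is the classical fact that only powers of a letter commute with it; here the
    equation also forces an arbitrary tree to be a word. Along the right spine, each left component
    is sent to the letter [a], which is smaller than the substituted tree, so [subst_small_inv]
    shows that the component was [a] already. *)
Lemma commute_eword_inv a t :
  tree_subst t (letter None) (Node (letter (Some a)) (letter None)) =
  Node (letter (Some a)) t -> exists n, t = eword (nseq n a).
Proof.
elim: t => [|t1 _ t2 IH] //.
have [->|ne] := eqVneq (Node t1 t2) (letter None); first by exists 0.
rewrite subst_Node; last exact/eqP.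
case/Node_inj=> E1 E2; have E : t1 = letter (Some a).
  have le_s : nodes (tree_subst t1 (letter None)
      (Node (letter (Some a)) (letter None))) <=
      nodes (Node (letter (Some a)) (letter None)).
    by rewrite E1 leqW // leq_addr.
  have [E|E] := subst_small_inv le_s; last by rewrite -E E1.
  by move: E1; rewrite E subst_letter eqxx => /letter_Node_inv.
have [n ->] : exists n, t2 = eword (nseq n a) by apply: IH; rewrite E2 E.
by rewrite E; exists n.+1.
Qed.

(** A component of the result is a letter, hence no larger than the replacing letter, so
    [subst_small_inv] applies to each component along the spine. *)
Lemma subst_word_inv t a b w :
  tree_subst t (letter (Some a)) (letter (Some b)) = eword w ->
  exists2 v, t = eword v & {subset v <= a :: w}.
Proof.
have small c u : tree_subst u (letter (Some a)) (letter (Some b)) = letter c ->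
    u = letter (Some a) \/ u = letter c.
  move=> E; have le_s : nodes (tree_subst u (letter (Some a)) (letter (Some b))) <=
      nodes (letter (Some b)) by rewrite E !nodes_letter.
  by have [->|<-] := subst_small_inv le_s; [left | rewrite E; right].
elim: w t => [|c w IH] t E.
  have [Et|->] := small _ _ E; last by exists [::].
  by move: E; rewrite Et subst_letter eqxx => /letter_inj.
case: t E => [|t1 t2] //.
have [->|ne] := eqVneq (Node t1 t2) (letter (Some a)).
  by rewrite subst_letter eqxx => /esym/letter_Node_inv.
rewrite subst_Node; last exact/eqP.
case/Node_inj=> /small E1 /IH[v -> sub_v].
have [x -> xin] : exists2 x, t1 = letter (Some x) & x \in [:: a; c].
  by case: E1 => ->; [exists a | exists c]; rewrite // !inE eqxx ?orbT.
exists (x :: v) => // y; rewrite inE => /predU1P[->|/sub_v].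
  by move: xin; rewrite !inE => /orP[]/eqP->; rewrite eqxx ?orbT.
by rewrite !inE => /orP[->//|->]; rewrite !orbT.
Qed.

(** The substitutions act one after the other, so a letter produced by one of them may be replaced
    again by a later one. *)
Definition recode (f : A -> A) (s : seq A) (t : tree) : tree :=
  foldl (fun t a => tree_subst t (letter (Some a)) (letter (Some (f a)))) t s.

(** Idempotence makes the successive substitutions agree with the simultaneous one: a letter already
    recoded is a fixed point of [f]. *)
Lemma recode_eword f s w : {subset w <= s} -> (forall x, f (f x) = f x) ->
  recode f s (eword w) = eword (map f w).
Proof.
move=> sub_ws ff; transitivity (eword [seq if x \in s then f x else x | x <- w]).
  rewrite /recode; elim: s w {sub_ws} => [|a s IH] w /=; first by rewrite map_id.
  rewrite subst_word IH -map_comp; congr eword; apply: eq_map => x /=.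
  rewrite inE; case: (x =P a) => [->|] //=.
  by rewrite ff if_same.
by congr eword; apply/eq_in_map => x /sub_ws ->.
Qed.

(** An unknown tree is recognized as a word, over a controlled alphabet, from its recoded image
    alone. *)
Lemma recode_inv f s t w : recode f s t = eword w ->
  exists2 v, t = eword v & {subset v <= s ++ w}.
Proof.
elim: s t => [|a s IH] t /=; first by exists w.
case/IH => v /subst_word_inv [v' -> sub_v'] sub_v; exists v' => // x /sub_v'.
by rewrite !inE => /orP[->//|/sub_v ->]; rewrite orbT.
Qed.

Definition numeral (n : nat) : tree := iter n (Node Leaf) Leaf.

Lemma numeral_inj : injective numeral.
Proof. by elim=> [|m IH] [|n] // [/IH->]. Qed.

(** This ties a block of equal letters, which encodes the input in unary, to the numeral that
    appears in the sentence. *)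
Lemma subst_numeral n a :
  tree_subst (tree_subst (eword (nseq n a)) (letter (Some a)) Leaf)
    (letter None) Leaf = numeral n.
Proof.
(* After the first substitution the spine must still be too large to be mistaken for the end marker
   before its end. *)
have ge_size m : letter_size <= nodes (iter m (Node Leaf) (letter None)).
  by elim: m => [|m IH]; rewrite ?nodes_letter //=; lia.
have -> : tree_subst (eword (nseq n a)) (letter (Some a)) Leaf =
    iter n (Node Leaf) (letter None).
  elim: n => [|n IH]; first by rewrite subst_letter.
  rewrite [eword _]/= -/(eword _) subst_Node; last exact/Node_neq_letter/nodes_eword.
  by rewrite IH subst_letter eqxx.
elim: n => [|n IH]; first by rewrite subst_letter eqxx.
by rewrite iterS subst_Node ?IH //; exact: Node_neq_letter.
Qed.
End Words.

(** * Counter machines and tilings *)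

(* [Copy x s] stores in register [x] the content of register [s], or zero when
   [s] is [None]. *)
Inductive atom : Type :=
| Inc (x : nat)
| Dec (x : nat)
| Zero (x : nat)
| Copy (x : nat) (s : option nat).

Lemma atom_comparable : comparable atom.
Proof. by move=> a b; rewrite /decidable; repeat decide equality. Qed.

HB.instance Definition _ := hasDecEq.Build atom (compareP atom_comparable).

Definition enabled (a : atom) (rho : nat -> nat) : bool :=
  match a with
  | Dec x => 0 < rho x
  | Zero x => rho x == 0
  | _ => true
  end.

Definition effect (a : atom) (rho : nat -> nat) : nat -> nat :=
  match a with
  | Inc x => [eta rho with x |-> (rho x).+1]
  | Dec x => [eta rho with x |-> (rho x).-1]
  | Zero _ => rho
  | Copy x s => [eta rho with x |-> oapp rho 0 s]
  end.

Definition target (a : atom) : nat :=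
  match a with Inc x | Dec x | Zero x | Copy x _ => x end.

(* On a row of columns, [Inc] and [Dec] act on one column, the other
   instructions on all of them. *)
Definition columnwise (a : atom) : bool :=
  match a with Inc _ | Dec _ => false | _ => true end.

(** A transition is chosen by its position in [E]; these positions become the horizontal colors of
    the tiles. *)
Inductive reach S (E : seq (S * atom * S)) :
    S -> (nat -> nat) -> S -> (nat -> nat) -> Prop :=
| ReachRefl q rho : reach E q rho q rho
| ReachStep i q rho q' rho' :
    let e := tnth (in_tuple E) i in
    e.1.1 = q -> enabled e.1.2 rho -> reach E e.2 (effect e.1.2 rho) q' rho' ->
    reach E q rho q' rho'.

Section Tiles.
Variables (S : eqType) (E : seq (S * atom * S)) (q0 qf : S).

Definition states : seq S := [:: q0, qf & [seq e.1.1 | e <- E] ++ [seq e.2 | e <- E]].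
(** Targets of instructions get a bit; [bit] reads false beyond the width, so all other registers
    hold zero. The successor ensures that register 0, which receives the input, has a bit. *)
Definition width := (\max_(e <- E) target e.1.2).+1.

Definition hcolor : finType := option 'I_(size E).
Definition column : finType := width.-tuple bool.
Definition vcolor : finType := ('I_(size states).+1 + column)%type.
Definition tile : finType := (vcolor * vcolor * hcolor * hcolor)%type.

Definition top (z : tile) := z.1.1.1.
Definition bot (z : tile) := z.1.1.2.
Definition left (z : tile) := z.1.2.
Definition right (z : tile) := z.2.

Definition src (i : 'I_(size E)) : S := (tnth (in_tuple E) i).1.1.
Definition act (i : 'I_(size E)) : atom := (tnth (in_tuple E) i).1.2.
Definition dst (i : 'I_(size E)) : S := (tnth (in_tuple E) i).2.

Definition state_color (q : S) : vcolor := inl (inord (index q states)).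

Definition bit (b : column) (x : nat) : bool := nth false b x.

Definition same_but (x : nat) (b b' : column) : bool :=
  [forall i : 'I_width, (i == x :> nat) || (tnth b i == tnth b' i)].

(* A row of tiles executes one transition: the head tile chooses it and
   announces it to the right; [None] announces that nothing is left to do. *)
Definition column_tile (b b' : column) (l r : hcolor) : bool :=
  if l is Some i then
    match act i with
    | Inc x => (r == l) && (b == b') ||
        [&& r == None, ~~ bit b x, bit b' x & same_but x b b']
    | Dec x => (r == l) && (b == b') ||
        [&& r == None, bit b x, ~~ bit b' x & same_but x b b']
    | Zero x => [&& r == l, b == b' & ~~ bit b x]
    | Copy x s => [&& r == l, bit b' x == oapp (bit b) false s & same_but x b b']
    end
  else (r == None) && (b == b').

(** The colors with which a row may end: an instruction acting on one column must have been carried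
    out by then, whereas a columnwise one travels through the whole row. *)
Definition accepting (l : hcolor) : bool := oapp (fun i => columnwise (act i)) true l.

(** A head tile also checks the preceding row: in the concatenated word, its left neighbour is the
    last tile of that row. *)
Definition is_tile (z : tile) : bool :=
  match top z, bot z with
  | inl q, inl q' => accepting (left z) &&
      [exists i, [&& right z == Some i, inl q == state_color (src i) &
        inl q' == state_color (dst i)]]
  | inr b, inr b' => column_tile b b' (left z) (right z)
  | _, _ => false
  end.

Fixpoint chain (l : hcolor) (Z : seq tile) (r : hcolor) : bool :=
  if Z is z :: Z' then (left z == l) && chain (right z) Z' r else l == r.

(** With [l] and [r] equal, this is the second word equation of the encoding. *)
Lemma chainP l Z r :
  reflect (l :: map right Z = rcons (map left Z) r) (chain l Z r).
Proof.
elim: Z l => [|z Z IH] l /=; first by apply: (iffP eqP) => [->|[]].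
apply: (iffP andP) => [[/eqP-> /IH->] // | [-> /IH ->]].
by rewrite eqxx.
Qed.

Lemma chain_cat l Z1 Z2 r :
  chain l (Z1 ++ Z2) r -> exists2 m, chain l Z1 m & chain m Z2 r.
Proof.
elim: Z1 l => [|z Z1 IH] l /=; first by exists l.
by case/andP=> -> /IH[m]; exists m.
Qed.

Lemma cat_chain l m Z1 Z2 r :
  chain l Z1 m -> chain m Z2 r -> chain l (Z1 ++ Z2) r.
Proof.
elim: Z1 l => [|z Z1 IH] l /=; first by move/eqP->.
by case/andP=> -> /IH h /h.
Qed.

Lemma head_inj q q' : q \in states -> q' \in states -> state_color q = state_color q' -> q = q'.
Proof.
have ltN q1 : index q1 states < (size states).+1 by rewrite ltnS index_size.
rewrite /state_color => /(nth_index q0) + /(nth_index q0); move: (ltN q) (ltN q').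
move: (index q states) (index q' states) => i j lt_i lt_j <- <-.
by case=> /(congr1 (@nat_of_ord _)); rewrite !inordK // => ->.
Qed.

Lemma src_states i : src i \in states.
Proof.
have Ei : src i \in [seq e.1.1 | e <- E].
  by apply: (map_f (fun e => e.1.1)); apply: mem_tnth.
by rewrite !inE mem_cat Ei !orbT.
Qed.

Lemma dst_states i : dst i \in states.
Proof.
have Ei : dst i \in [seq e.2 | e <- E] by apply: map_f; apply: mem_tnth.
by rewrite !inE mem_cat Ei !orbT.
Qed.

Lemma target_lt i : target (act i) < width.
Proof.
rewrite ltnS /act; have := mem_tnth i (in_tuple E); move: (tnth _ i) => e Ee.
exact: (leq_bigmax_seq (F := fun e : S * atom * S => target e.1.2) e Ee).
Qed.

Lemma same_butP x b b' y : same_but x b b' -> y != x -> bit b y = bit b' y.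
Proof.
move/forallP=> same ne; case: (ltnP y width) => [lt_y|le_y].
  have /predU1P[E1|/eqP] := same (Ordinal lt_y); first by rewrite -E1 eqxx in ne.
  by rewrite !(tnth_nth false).
by rewrite /bit !nth_default ?size_tuple.
Qed.

(** * From tilings to runs *)

Definition value (s : seq column) (x : nat) : nat := count (bit^~ x) s.
Arguments value : simpl never.

(** Induction over the suffixes of the row: a suffix entered with [Some i] performs the whole
    instruction on its own columns, and a suffix entered with [None] is copied. *)
Lemma row_sound l Z r s :
  all is_tile Z -> chain l Z r -> accepting r -> map top Z = map inr s ->
  exists2 s', map bot Z = map inr s' &
    if l is Some i then
      enabled (act i) (value s) /\ value s' = effect (act i) (value s)
    else s' = s.
Proof.
elim: Z l s => [|[[[t b] l'] r'] Z IH] l [|c s] //=.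
  (* On an empty suffix all registers are zero, so [Zero] succeeds and [Copy] has no effect;
     [accepting] excludes [Inc] and [Dec]. *)
  move=> _ /eqP-> acc_r _; exists [::] => //; case: r acc_r => //= i.
  case: (act i) => //= x u _; split=> //; apply: functional_extensionality => y /=.
  by case: u => [u|] /=; rewrite /value /=; case: ifP.
case/andP; rewrite /is_tile /top /bot /left /right /= => Tz TZ /andP[/eqP El chZ] acc_r.
case=> Et topZ; subst t l'; case: b Tz => // c' Tz.
have [s' botZ Hs'] := IH _ _ TZ chZ acc_r topZ; exists (c' :: s'); first by rewrite botZ.
case: l Tz => [i|] /=; last by case/andP=> /eqP Er /eqP <-; rewrite Er in Hs'; rewrite Hs'.
have val1 d u y : value (d :: u) y = bit d y + value u y by [].
case Ea: (act i) => [x|x|x|x u].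
- case/orP=> [/andP[/eqP Er /eqP <-]|/and4P[/eqP Er bx b'x same]]; move: Hs'; rewrite Er.
    rewrite Ea => -[_ /= Es']; split=> //; apply: functional_extensionality => y.
    by rewrite /= !val1 Es' /=; case: eqP => [->|_]; lia.
  move=> ->; split=> //; apply: functional_extensionality => y.
  rewrite /= !val1; case: eqP => [->|/eqP /(same_butP same)->] //.
  by rewrite b'x (negPf bx).
- case/orP=> [/andP[/eqP Er /eqP <-]|/and4P[/eqP Er bx b'x same]]; move: Hs'; rewrite Er.
    rewrite Ea => -[/= pos Es']; split; first by rewrite val1; lia.
    apply: functional_extensionality => y.
    by rewrite /= !val1 Es' /=; case: eqP => [->|_]; lia.
  move=> ->; split; first by rewrite /= val1 bx.
  apply: functional_extensionality => y.
  rewrite /= !val1; case: eqP => [->|/eqP /(same_butP same)->] //.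
  by rewrite bx (negPf b'x).
- case/and3P=> /eqP Er /eqP <- nbx; move: Hs'; rewrite Er Ea => -[/= /eqP z0 Es'].
  split; first by rewrite val1 (negPf nbx) z0.
  by apply: functional_extensionality => y; rewrite !val1 Es'.
case/and3P=> /eqP Er /eqP bx same; move: Hs'; rewrite Er Ea => -[_ /= Es'].
split=> //; apply: functional_extensionality => y.
rewrite /= !val1 Es' /=; case: eqP => [->|/eqP /(same_butP same)->] //.
by rewrite bx; case: (u).
Qed.

(** A state color is not a column, so it cannot occur before the configuration [s] has been read
    completely; this cuts one row off the word. *)
Lemma split_row Z (s : seq column) q u w :
  map top Z ++ state_color q :: u = map inr s ++ w ->
  exists Z1 Z2, [/\ Z = Z1 ++ Z2, map top Z1 = map inr s & map top Z2 ++ state_color q :: u = w].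
Proof.
elim: s Z => [|c s IH] [|z Z] //= E1; first by exists [::], [::].
  by exists [::], (z :: Z).
case: E1 => tz /IH[Z1 [Z2 [-> topZ1 topZ2]]]; exists (z :: Z1), Z2; split=> //=.
by rewrite tz topZ1.
Qed.

(** Removing the first row preserves the equation, with the lower colors of that row as the new
    configuration; hence strong induction on the length of [Z]. *)
Lemma picture_sound l Z r q s u :
    all is_tile Z -> chain l Z r -> accepting r -> q \in states ->
    map top Z ++ state_color qf :: u = state_color q :: map inr s ++ map bot Z ->
  exists rho, reach E q (value s) qf rho.
Proof.
have [m] := ubnP (size Z); elim: m => // m IHm in l Z q s *.
case: Z => [|z Z] szZ /= TZ chZ acc_r qs.
  case=> Eq _; rewrite (@head_inj q qf) ?inE ?eqxx ?orbT //; last by rewrite /state_color Eq.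
  by exists (value s); apply: ReachRefl.
case/andP: TZ => Tz TZ; case/andP: chZ => _ chZ [tz].
have [p bz]: exists p, bot z = inl p.
  by move: Tz; rewrite /is_tile tz; case: (bot z) => // p _; exists p.
move: Tz; rewrite /is_tile tz bz => /andP[_ /existsP[i /and3P[/eqP rz /eqP Eq /eqP Ep]]].
have {Eq} Eq : q = src i by apply: head_inj => //; apply: src_states.
rewrite Ep => /split_row[Z1 [Z2 [EZ topZ1 topZ2]]].
subst Z; move: TZ; rewrite all_cat => /andP[TZ1 TZ2].
have [r1 ch1 ch2] := chain_cat chZ.
(* After the row comes either the end of the word or a tile with a state on top, that is, a head
   tile, which checks its left color. *)
have acc1 : accepting r1.
  case: (Z2) topZ2 TZ2 ch2 => [|z2 Z2'] /=; first by move=> _ _ /eqP ->.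
  case=> t2 _ /andP[+ _] /andP[/eqP<- _].
  by rewrite /is_tile t2; case: (bot z2) => // ? /andP[].
rewrite rz in ch1.
have [s' botZ1 [en eff]] := row_sound TZ1 ch1 acc1 topZ1.
move: topZ2; rewrite map_cat botZ1 => topZ2.
have szZ2 : size Z2 < m by move: szZ; rewrite /= size_cat; lia.
have [rho R] := IHm _ _ _ _ szZ2 TZ2 ch2 acc_r (dst_states i) topZ2.
by exists rho; apply: (@ReachStep _ _ i); rewrite //= -/(act i) -eff.
Qed.

(** * From runs to tilings *)

Definition set_bit (x : nat) (v : bool) (b : column) : column :=
  [tuple (if i == x :> nat then v else tnth b i) | i < width].

Lemma bit_set x v b : x < width -> bit (set_bit x v b) x = v.
Proof.
by move=> lt_x; rewrite /bit -(tnth_nth false _ (Ordinal lt_x)) tnth_mktuple eqxx.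
Qed.

Lemma same_but_set x v b : same_but x b (set_bit x v b).
Proof. by apply/forallP=> i; rewrite tnth_mktuple; case: eqP => //= _. Qed.

Definition zip_row (s s' : seq column) (l : hcolor) : seq tile :=
  [seq (inr p.1, inr p.2, l, l) : tile | p <- zip s s'].

Lemma zip_rowP s f l :
    (forall b, b \in s -> column_tile b (f b) l l) ->
  let Z := zip_row s (map f s) l in
  [/\ all is_tile Z, chain l Z l, map top Z = map inr s & map bot Z = map inr (map f s)].
Proof.
elim: s => [|b s IH] Hf; first by split=> //=.
have [|T C t p] := IH; first by move=> c cs; apply: Hf; rewrite inE cs orbT.
split=> /=; rewrite ?t ?p ?eqxx //= -/(is_tile _).
by apply/andP; split; [apply: Hf; rewrite mem_head | exact: T].
Qed.

(** The bound on the target register guarantees a column whose bit is clear, which [Inc] can set. *)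
Lemma row_complete i s :
    enabled (act i) (value s) ->
    value s (target (act i)) < size s ->
  exists Z r s', [/\ all is_tile Z, chain (Some i) Z r /\ accepting r, map top Z = map inr s,
    map bot Z = map inr s' & value s' = effect (act i) (value s) /\ size s' = size s].
Proof.
(* Common treatment of [Inc] ([v] true) and [Dec] ([v] false): the first suitable column is changed,
   the columns before it pass the instruction on, and those after it are copied. A summand on either
   side of the equation avoids subtraction. *)
have flip v x (l := Some i) : x < width -> has (fun b => bit b x == ~~ v) s ->
    (forall b, column_tile b b l l) ->
    (forall b, bit b x == ~~ v -> column_tile b (set_bit x v b) l None) ->
  exists Z s', [/\ all is_tile Z, chain l Z None, map top Z = map inr s,
    map bot Z = map inr s' &
      size s' = size s /\ forall y, value s' y + (~~ v) * (y == x) = value s y + v * (y == x)].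
  move=> ltx; case/split_find => b s1 s2 bx _ keep change.
  have same (l' : hcolor) u : (forall b, column_tile b b l' l') -> let Z := zip_row u u l' in
      [/\ all is_tile Z, chain l' Z l', map top Z = map inr u & map bot Z = map inr u].
    move=> h; have := @zip_rowP u id l'; rewrite map_id; apply=> c _; exact: h.
  have [T1 C1 t1 p1] := same l s1 keep.
  have [|T2 C2 t2 p2] := same None s2; first by move=> c /=; rewrite eqxx.
  exists (zip_row s1 s1 l ++ (inr b, inr (set_bit x v b), l, None) :: zip_row s2 s2 None).
  exists (s1 ++ set_bit x v b :: s2).
  rewrite cat_rcons; split.
  - by rewrite all_cat T1 /= T2 andbT; apply: change.
  - by apply: cat_chain C1 _; rewrite /= eqxx.
  - by rewrite !map_cat /= t1 t2.
  - by rewrite !map_cat /= p1 p2.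
  split=> [|y]; first by rewrite !size_cat.
  rewrite /value !count_cat /=; case: (y =P x) => [->|/eqP ne].
    by rewrite bit_set // (eqP bx); case: (v); lia.
  by rewrite (same_butP (same_but_set x v b) ne); lia.
have lt_t := target_lt i.
case Ea: (act i) lt_t => [x|x|x|x u] /= ltx en big.
- have [|b|b /eqP bx|Z [s' [T C t p [sz val']]]] := flip true x ltx.
  + apply: contraTT big => /hasPn h; rewrite -leqNgt.
    rewrite /value (_ : count _ s = size s) //; apply/eqP; rewrite -all_count.
    by apply/allP=> b /h; case: (bit b x).
  + by rewrite /column_tile Ea !eqxx.
  + by rewrite /column_tile Ea bx bit_set // same_but_set orbT.
  exists Z, None, s'; split=> //; split=> //; apply: functional_extensionality => y /=.
  by have := val' y; case: (y =P x) => [->|] /=; lia.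
- have [|b|b /eqP bx|Z [s' [T C t p [sz val']]]] := flip false x ltx.
  + by rewrite has_count (eq_count (a2 := bit^~ x)) // => b; rewrite eqb_id.
  + by rewrite /column_tile Ea !eqxx.
  + by rewrite /column_tile Ea bx bit_set // same_but_set orbT.
  exists Z, None, s'; split=> //; split=> //; apply: functional_extensionality => y /=.
  by have := val' y; case: (y =P x) => [->|] /=; lia.
- have [|T C t p] := @zip_rowP s id (Some i).
    move=> b bs; rewrite /column_tile Ea !eqxx /=; apply: contraTN en => bx.
    by rewrite -lt0n -has_count; apply/hasP; exists b.
  rewrite map_id in T C t p; exists (zip_row s s (Some i)), (Some i), s.
  by split=> //; split=> //; rewrite /accepting /= Ea.
have [|T C t p] := @zip_rowP s (fun b => set_bit x (oapp (bit b) false u) b) (Some i).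
  by move=> b bs; rewrite /column_tile Ea !eqxx /= bit_set // eqxx same_but_set.
eexists _, (Some i), _; split; [exact: T | split=> // | exact: t | exact: p | ].
  by rewrite /accepting /= Ea.
split; last by rewrite size_map.
apply: functional_extensionality => y /=; rewrite /value count_map.
case: eqP => [->|/eqP ne].
  rewrite (eq_count (a2 := fun b => oapp (bit b) false u)) => [|b]; last by rewrite /= bit_set.
  by case: (u) => //=; rewrite count_pred0.
by apply: eq_count => b; apply/esym/same_butP/ne; apply: same_but_set.
Qed.

(** The word [u] stands for the columns of the halting configuration. *)
Definition is_picture (q : S) (s : seq column) (Z : seq tile) (u : seq vcolor) : Prop :=
  all is_tile Z /\ map top Z ++ state_color qf :: u = state_color q :: map inr s ++ map bot Z.

(** All rows have the same length, so [N] has to suffice for the whole run. The final color [r] is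
    independent of the initial color [l], which can therefore be chosen equal to [r] to close the
    chain. An empty word would force [l = r], whence the separate alternative [q = qf]. *)
Lemma picture_complete_step q rho q' rho' :
    reach E q rho q' rho' -> q' = qf -> q = qf \/
  exists N, forall s, N <= size s -> value s = rho -> exists u r, accepting r /\
    forall l, accepting l -> exists2 Z, is_picture q s Z u & chain l Z r.
Proof.
elim=> {q rho q' rho'} [q rho ->|i q rho q' rho' /= Eq en _ IH Eqf]; first by left.
right; have [N HN] : exists N, forall s, N <= size s -> value s = effect (act i) rho ->
    exists u r, accepting r /\ forall l, accepting l ->
    (exists2 Z, is_picture (dst i) s Z u & chain l Z r) \/ (dst i = qf /\ u = map inr s).
  have [Ed|[N HN]] := IH Eqf.
    by exists 0 => s _ _; exists (map inr s), None; split=> // l _; right.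
  exists N => s /HN h /h [u [r [acc Z]]]; exists u, r; split=> // l /Z; by left.
(* One column more than the target register counts leaves room for an increment. *)
exists (maxn N (rho (target (act i))).+1) => s; rewrite geq_max => /andP[leN big] Es.
have [||Z1 [r1 [s' [T1 [C1 acc1] t1 p1 [val' sz']]]]] := @row_complete i s.
- by rewrite Es.
- by rewrite Es.
rewrite -sz' in leN; rewrite Es in val'.
have [u [r [acc HZ]]] := HN _ leN val'.
pose z l : tile := (state_color q, state_color (dst i), l, Some i).
have Tz l : accepting l -> is_tile (z l).
  move=> al; rewrite /is_tile /= al /=; apply/existsP; exists i.
  by rewrite -Eq !eqxx.
have [[Z2 [T2 E2] C2]|[Ed Eu]] := HZ r1 acc1.
  exists u, r; split=> // l al; exists (z l :: Z1 ++ Z2).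
    split; first by rewrite /= Tz // all_cat T1.
    by rewrite /= !map_cat t1 p1 -catA E2.
  by rewrite /= eqxx; apply: cat_chain C1 C2.
exists u, r1; split=> // l al; exists (z l :: Z1).
  split; first by rewrite /= Tz.
  by rewrite /= t1 p1 Eu -Ed.
by rewrite /= eqxx.
Qed.

Lemma reach_picture rho (rows : nat -> seq column) :
    (forall N, N <= size (rows N)) -> (forall N, value (rows N) = rho) ->
    (exists rho', reach E q0 rho qf rho') ->
  exists N Z u d, is_picture q0 (rows N) Z u /\ chain d Z d.
Proof.
move=> big val_rows [rho' R]; have [Eq|[N HN]] := picture_complete_step R erefl.
  exists 0, [::], (map inr (rows 0)), None.
  by split=> //; rewrite /is_picture /= cats0 Eq.
have [u [r [acc /(_ r acc) [Z pic ch]]]] := HN _ (big N) (val_rows N).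
by exists N, Z, u, r.
Qed.

Lemma picture_reach s Z u d :
  is_picture q0 s Z u -> chain d Z d -> exists rho', reach E q0 (value s) qf rho'.
Proof.
move=> [TZ EZ] C; have q0s : q0 \in states by rewrite mem_head.
(* For the empty word [d] may fail to be accepting, so [None] takes its place. Otherwise [d] is the
   left color of the first tile, a head tile, and is therefore accepting. *)
case: Z => [|z Z] in TZ EZ C *; first exact: (picture_sound (l := None) TZ (eqxx _) isT q0s EZ).
apply: (picture_sound TZ (C) _ q0s EZ).
case/andP: TZ => + _; move: C => /= /andP[/eqP<- _]; rewrite /is_tile; case: EZ => -> _.
by case: (bot z) => // p /andP[].
Qed.
End Tiles.

(** * Structured programs *)

(** [Star] is a nondeterministic loop; conditions are expressed by [Dec] and [Zero], which block the
    runs that iterate or leave the loop at the wrong time. *)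
Inductive prog : Type :=
| Atom (a : atom)
| Seq (p q : prog)
| Star (p : prog).

Lemma prog_comparable : comparable prog.
Proof.
move=> p q; rewrite /decidable; decide equality; exact: (eq_comparable a a0).
Qed.

HB.instance Definition _ := hasDecEq.Build prog (compareP prog_comparable).

Inductive star (R : (nat -> nat) -> (nat -> nat) -> Prop) : (nat -> nat) -> (nat -> nat) -> Prop :=
| StarRefl rho : star R rho rho
| StarStep rho rho' rho'' : R rho rho' -> star R rho' rho'' -> star R rho rho''.

Fixpoint exec (p : prog) (rho rho' : nat -> nat) : Prop :=
  match p with
  | Atom a => enabled a rho /\ rho' = effect a rho
  | Seq p q => exists2 rho1, exec p rho rho1 & exec q rho1 rho'
  | Star p => star (exec p) rho rho'
  end.

Fixpoint exec_all (k : seq prog) (rho rho' : nat -> nat) : Prop :=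
  if k is p :: k' then exists2 rho1, exec p rho rho1 & exec_all k' rho1 rho' else rho' = rho.

Definition skip : atom := Copy 0 (Some 0).

Lemma effect_skip rho : effect skip rho = rho.
Proof. by apply: functional_extensionality => x /=; case: eqP => [->|]. Qed.

(* The states are stacks of programs that remain to be executed. *)
Fixpoint trans (p : prog) (k : seq prog) : seq (seq prog * atom * seq prog) :=
  match p with
  | Atom a => [:: (Atom a :: k, a, k)]
  | Seq p1 p2 => (Seq p1 p2 :: k, skip, [:: p1, p2 & k]) :: trans p1 (p2 :: k) ++ trans p2 k
  | Star p1 => [:: (Star p1 :: k, skip, k), (Star p1 :: k, skip, [:: p1, Star p1 & k]) &
                trans p1 (Star p1 :: k)]
  end.

(** A stack determines what remains to be executed, so each transition is sound by itself, even if
    equal stacks arise at different places of the program. The meaning of a stack is pulled back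
    along the run from its halting end. *)
Lemma trans_sound p k e rho rho' :
  e \in trans p k -> enabled e.1.2 rho ->
  exec_all e.2 (effect e.1.2 rho) rho' -> exec_all e.1.1 rho rho'.
Proof.
elim: p k => [a|p1 IH1 p2 IH2|p1 IH1] k; rewrite !inE.
- by move=> /eqP-> /= en ex; exists (effect a rho).
- rewrite mem_cat => /or3P[/eqP->|/IH1//|/IH2//].
  by move=> _ [rho1]; rewrite effect_skip => ex1 [rho2 ex2 ex]; exists rho2 => //; exists rho1.
case/or3P=> [/eqP->|/eqP->|/IH1//] _; rewrite [(_, _).1.2]/= effect_skip /=.
  by exists rho => //; apply: StarRefl.
by case=> [rho1 ex1 [rho2 ex2 ex]]; exists rho2 => //; apply: StarStep ex1 ex2.
Qed.

Lemma reach_exec p rho rho' :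
  reach (trans p [::]) [:: p] rho [::] rho' -> exec p rho rho'.
Proof.
move=> R; suff [rho1 ex /= ->] : exec_all [:: p] rho rho' by [].
have {R} : exists2 k, k = [::] & reach (trans p [::]) [:: p] rho k rho' by exists [::].
case=> k + R; elim: R => {rho rho' k} [k rho -> //|i k rho k' rho' /= Ek en _ IH /IH ex].
by rewrite -Ek; apply: trans_sound en ex; apply: mem_tnth.
Qed.

Lemma reach_trans S (E : seq (S * atom * S)) q1 rho1 q2 rho2 q3 rho3 :
  reach E q1 rho1 q2 rho2 -> reach E q2 rho2 q3 rho3 -> reach E q1 rho1 q3 rho3.
Proof.
elim=> // i {}q1 {}rho1 {}q2 {}rho2 /= Eq en _ IH /IH; exact: ReachStep.
Qed.

Lemma reach1 (S : eqType) (E : seq (S * atom * S)) q a q' rho :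
  (q, a, q') \in E -> enabled a rho -> reach E q rho q' (effect a rho).
Proof.
move=> /(tnthP (in_tuple E))[i Ei] en.
by apply: (@ReachStep _ _ i); rewrite -Ei //; apply: ReachRefl.
Qed.

Lemma exec_reach p k E rho rho' : {subset trans p k <= E} ->
  exec p rho rho' -> reach E (p :: k) rho k rho'.
Proof.
elim: p k rho rho' => [a|p1 IH1 p2 IH2|p1 IH1] k rho rho' subE /=.
- by case=> en ->; apply: reach1 => //; apply: subE; rewrite inE.
- case=> rho1 ex1 ex2.
  have first : reach E (Seq p1 p2 :: k) rho [:: p1, p2 & k] rho.
    by rewrite -{2}(effect_skip rho); apply: reach1 => //; apply: subE; rewrite mem_head.
  apply: (reach_trans first); apply: (reach_trans (IH1 (p2 :: k) _ _ _ ex1)) => [e Ee|].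
    by apply: subE; rewrite inE mem_cat Ee orbT.
  by apply: IH2 ex2 => e Ee; apply: subE; rewrite inE mem_cat Ee !orbT.
elim=> {rho rho'} [rho|rho rho1 rho2 ex1 _ IH].
  by rewrite -{2}(effect_skip rho); apply: reach1 => //; apply: subE; rewrite mem_head.
have first : reach E (Star p1 :: k) rho [:: p1, Star p1 & k] rho.
  by rewrite -{2}(effect_skip rho); apply: reach1 => //; apply: subE; rewrite !inE eqxx orbT.
apply: reach_trans first _; apply: reach_trans IH; apply: IH1 ex1 => e Ee.
by apply: subE; rewrite !inE Ee !orbT.
Qed.

Fixpoint seqs (ps : seq prog) : prog :=
  if ps is p :: ps' then Seq p (seqs ps') else Atom skip.

(* [compile f ins b] stores in register [b] a value of [f] at the contents of
   the registers [ins], which are below [b]; it uses the registers above [b]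
   as scratch space and leaves those below [b] unchanged. *)
Fixpoint compile n (f : recfun n) (ins : seq nat) (b : nat) : prog :=
  match f with
  | RZero _ => Atom (Copy b None)
  | RSucc => Seq (Atom (Copy b (Some (nth 0 ins 0)))) (Atom (Inc b))
  | RProj _ i => Atom (Copy b (Some (nth 0 ins i)))
  | RComp k _ f g =>
      Seq (seqs [seq compile (g i) ins (b + i) | i <- enum 'I_k])
        (Seq (compile f (iota b k) (b + k)) (Atom (Copy b (Some (b + k)))))
  | RPrec _ f g =>
      Seq (Seq (Seq (compile f (behead ins) b.+2) (Atom (Copy b.+1 (Some b.+2))))
        (Seq (Atom (Copy b None)) (Atom (Copy b.+2 (Some (nth 0 ins 0))))))
      (Seq (Star (Seq (Seq (Atom (Dec b.+2)) (compile g [:: b, b.+1 & behead ins] b.+3))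
        (Seq (Atom (Copy b.+1 (Some b.+3))) (Atom (Inc b)))))
      (Seq (Atom (Zero b.+2)) (Atom (Copy b (Some b.+1)))))
  | RMu _ f =>
      Seq (Atom (Copy b None))
      (Seq (Star (Seq (compile f (b :: ins) b.+1) (Seq (Atom (Dec b.+1)) (Atom (Inc b)))))
        (Seq (compile f (b :: ins) b.+1) (Atom (Zero b.+1))))
  end.

(** * Compilation of recursive functions *)

Definition agree (b : nat) (rho rho' : nat -> nat) : Prop :=
  forall x, x < b -> rho' x = rho x.

Lemma agree_trans b rho1 rho2 rho3 :
  agree b rho1 rho2 -> agree b rho2 rho3 -> agree b rho1 rho3.
Proof. by move=> A12 A23 x lt_xb; rewrite A23 ?A12. Qed.

Lemma agree_leq b c rho rho' : b <= c -> agree c rho rho' -> agree b rho rho'.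
Proof. by move=> le_bc Ac x lt_xb; rewrite Ac // (leq_trans lt_xb). Qed.

Lemma agree_effect b a rho : b <= target a -> agree b rho (effect a rho).
Proof.
by case: a => [x|x|x|x s] /= le_bx y lt_yb //=; case: eqP => // E1; lia.
Qed.

Ltac lookup := rewrite /=; repeat (case: eqP => ?; try (exfalso; lia)).

Lemma star_trans R rho1 rho2 rho3 :
  star R rho1 rho2 -> star R rho2 rho3 -> star R rho1 rho3.
Proof. by elim=> // {}rho1 {}rho2 rho4 R12 _ IH /IH; apply: StarStep. Qed.

Definition args n (ins : n.-tuple nat) (rho : nat -> nat) : n.-tuple nat := map_tuple rho ins.

Lemma agree_args n (ins : n.-tuple nat) b rho rho' :
  all (ltn^~ b) ins -> agree b rho rho' -> args ins rho' = args ins rho.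
Proof.
move=> /allP lt_b A; apply: val_inj => /=; apply/eq_in_map => x /lt_b; exact: A.
Qed.

Lemma args_cons n x (ins : n.-tuple nat) rho :
  args [tuple of x :: ins] rho = [tuple of rho x :: args ins rho].
Proof. exact: val_inj. Qed.

(** Programs are nondeterministic, so correctness of every finished run and existence of a run are
    two separate demands. *)
Definition realizes (p : prog) (b : nat) (F : (nat -> nat) -> nat -> Prop) : Prop :=
  (forall rho rho', exec p rho rho' -> F rho (rho' b) /\ agree b rho rho') /\
  (forall rho y, F rho y -> exists rho', [/\ exec p rho rho', rho' b = y & agree b rho rho']).

Definition correct n (f : recfun n) : Prop :=
  forall (ins : n.-tuple nat) b, all (ltn^~ b) ins ->
  realizes (compile f ins b) b (fun rho => computes f (args ins rho)).

Lemma all_ltnW (s : seq nat) b c : b <= c -> all (ltn^~ b) s -> all (ltn^~ c) s.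
Proof. by move=> le_bc; apply: sub_all => x /leq_trans; apply. Qed.

(** The program for [g i] may overwrite everything above register [b + i]; running the programs in
    increasing order of [i] preserves the results already stored. *)
Lemma correct_seqs k n (g : 'I_k -> recfun n) (ins : n.-tuple nat) b (s : seq 'I_k) :
    (forall i, correct (g i)) -> all (ltn^~ b) ins -> pairwise ltn (map val s) ->
  let p := seqs [seq compile (g i) ins (b + i) | i <- s] in
  let keeps rho rho' := forall x, {in s, forall i : 'I_k, x < b + i} -> rho' x = rho x in
  (forall rho rho', exec p rho rho' -> keeps rho rho' /\
    {in s, forall i : 'I_k, computes (g i) (args ins rho) (rho' (b + i))}) /\
  (forall rho w, {in s, forall i : 'I_k, computes (g i) (args ins rho) (w i)} ->
    exists rho', [/\ exec p rho rho', keeps rho rho' &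
      {in s, forall i : 'I_k, rho' (b + i) = w i}]).
Proof.
move=> Hg lt_b; elim: s => [|i s IH].
  move=> _; split=> [rho _ [_ ->]|rho w _]; first by rewrite effect_skip.
  by exists rho; split=> //; split; rewrite ?effect_skip.
rewrite /=; case/andP=> lt_i /IH[sound complete].
have [sound1 complete1] := Hg i ins (b + i) (all_ltnW (leq_addr _ _) lt_b).
have keep_i x : {in i :: s, forall j : 'I_k, x < b + j} ->
    x < b + i /\ {in s, forall j : 'I_k, x < b + j}.
  by move=> h; split=> [|j js]; apply: h; rewrite inE ?eqxx ?js ?orbT.
have i_small : {in s, forall j : 'I_k, b + i < b + j}.
  by move=> j js; rewrite ltn_add2l; apply: (allP lt_i); apply: map_f.
split=> [rho rho' [rho1 /sound1[val_i A1] /sound[keep vals]]|rho w Hw].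
  split=> [x /keep_i[lt_xi lt_xs]|j].
    by rewrite keep // A1.
  rewrite inE => /predU1P[->|/vals]; first by rewrite keep.
  by rewrite (agree_args lt_b (agree_leq (leq_addr _ _) A1)).
have [|rho1 [ex1 val_i A1]] := complete1 rho (w i); first by apply: Hw; rewrite mem_head.
have A1b := agree_leq (leq_addr i b) A1.
have [j js|rho' [ex keep vals]] := complete rho1 w.
  by rewrite (agree_args lt_b A1b); apply: Hw; rewrite inE js orbT.
exists rho'; split; first by exists rho1.
  by move=> x /keep_i[lt_xi lt_xs]; rewrite keep // A1.
by move=> j; rewrite inE => /predU1P[->|/vals//]; rewrite keep.
Qed.

Lemma pairwise_enum k : pairwise ltn (map val (enum 'I_k)).
Proof. by rewrite val_enum_ord -sorted_pairwise ?iota_ltn_sorted //; apply: ltn_trans. Qed.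

Lemma correct_comp k n (f : recfun k) (g : 'I_k -> recfun n) :
  correct f -> (forall i, correct (g i)) -> correct (RComp f g).
Proof.
move=> Hf Hg ins b lt_b.
have [sound complete] := correct_seqs Hg lt_b (pairwise_enum k).
have lt_iota : all (ltn^~ (b + k)) [tuple of iota b k].
  by apply/allP => x; rewrite mem_iota => /andP[].
have [soundf completef] := Hf _ _ lt_iota.
have argsE rho : args [tuple of iota b k] rho = [tuple rho (b + i) | i < k].
  by apply: eq_from_tnth => i; rewrite tnth_map tnth_mktuple (tnth_nth 0) nth_iota.
have small x : x < b -> {in enum 'I_k, forall i : 'I_k, x < b + i}.
  by move=> lt_xb i _; apply: ltn_addr.
split=> [rho rho' /= [rho1 /sound[keep vals] [rho2 /soundf[val2 A2] [_ ->]]]|rho y /= [w Hw fy]].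
  split; last first.
    apply: (agree_trans _ (agree_effect (a := Copy b (Some (b + k))) _ (leqnn b))) =>  x ltx.
    by rewrite A2 ?keep //; [apply: small | apply: ltn_addr].
  rewrite /= eqxx; exists (args [tuple of iota b k] rho1) => // i.
  by rewrite argsE tnth_mktuple; apply: vals; rewrite mem_enum.
have [i _|rho1 [ex1 keep vals]] := complete rho (tnth w); first exact: Hw.
have [|rho2 [ex2 val2 A2]] := completef rho1 y.
  suff -> : args [tuple of iota b k] rho1 = w by [].
  by apply: eq_from_tnth => i; rewrite argsE tnth_mktuple vals ?mem_enum.
exists (effect (Copy b (Some (b + k))) rho2); split.
- by exists rho1 => //; exists rho2.
- by rewrite /= eqxx.
apply: (agree_trans _ (agree_effect (a := Copy b (Some (b + k))) _ (leqnn b))) =>  x ltx.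
by rewrite A2 ?keep //; [apply: small | apply: ltn_addr].
Qed.

(** Register [b] holds the candidate. [Dec] lets an iteration pass only if the value at the
    candidate is nonzero, and the final [Zero] accepts only a zero; the loop invariant is
    [below]. *)
Lemma correct_mu n (f : recfun n.+1) : correct f -> correct (RMu f).
Proof.
move=> Hf ins b lt_b.
have lt_b1 : all (ltn^~ b.+1) [tuple of b :: ins].
  by rewrite /= ltnSn (all_ltnW (leqnSn b)).
have [soundf completef] := Hf _ _ lt_b1.
rewrite /= in soundf completef.
pose body := Seq (compile f (b :: ins) b.+1) (Seq (Atom (Dec b.+1)) (Atom (Inc b))).
have body_sound rho rho' : exec body rho rho' -> [/\ rho' b = (rho b).+1, agree b rho rho' &
    exists u, computes f [tuple of rho b :: args ins rho] u.+1].
  case=> rho1 /soundf[]; rewrite args_cons => val1 A1 [_ [/= pos ->] [_ ->]]; split.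
  - by lookup; rewrite A1.
  - by move=> x ltx; lookup; rewrite A1 // ltnW.
  by exists (rho1 b.+1).-1; rewrite prednK.
have body_complete rho u : computes f [tuple of rho b :: args ins rho] u.+1 ->
    exists rho', [/\ exec body rho rho', rho' b = (rho b).+1 & agree b rho rho'].
  rewrite -args_cons => /completef[rho1 [ex1 val1 A1]].
  exists (effect (Inc b) (effect (Dec b.+1) rho1)); split.
  - exists rho1 => //; exists (effect (Dec b.+1) rho1) => //=.
    by rewrite val1.
  - by lookup; rewrite A1.
  by move=> x ltx; lookup; rewrite A1 // ltnW.
pose below rho j := forall z, z < j -> exists u, computes f [tuple of z :: args ins rho] u.+1.
have loop_sound rho rho' : star (exec body) rho rho' -> below rho (rho b) ->
    below rho (rho' b) /\ agree b rho rho'.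
  elim=> {rho rho'} [//|rho rho1 rho' /body_sound[b1 A1 [u fu]] _ IH bel].
  move: IH; rewrite /below (agree_args lt_b A1) b1 => -[z|bel' A'].
    by rewrite ltnS leq_eqVlt => /predU1P[->|/bel//]; exists u.
  by split=> //; apply: agree_trans A1 A'.
have loop_complete rho j : rho b = 0 -> below rho j ->
    exists rho', [/\ star (exec body) rho rho', rho' b = j & agree b rho rho'].
  move=> b0; elim: j => [|j IH] bel; first by exists rho; split=> //; apply: StarRefl.
  have [z lt_zj|rho1 [ex1 b1 A1]] := IH; first by apply: bel; apply: ltnW.
  have [u] := bel j (ltnSn j); rewrite -b1 -(agree_args lt_b A1).
  case/body_complete => rho2 [ex2 b2 A2]; exists rho2; split.
  - by apply: star_trans ex1 (StarStep ex2 (StarRefl _ _)).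
  - by rewrite b2 b1.
  exact: agree_trans A1 A2.
have A0 rho : agree b rho (effect (Copy b None) rho) by apply: agree_effect.
split=> [rho rho' /=|rho y /= [f0 bel]].
  case=> _ [_ ->] [rho1 /loop_sound].
  rewrite /below (agree_args lt_b (A0 rho)) /= eqxx => -[//|bel A1].
  case=> rho2 /soundf[]; rewrite args_cons => val2 A2 [/= /eqP z0 ->].
  have A01 := agree_trans (A0 rho) A1.
  rewrite z0 (agree_args lt_b A01) in val2; rewrite A2 //; split=> //.
  by apply: agree_trans A01 _; apply: agree_leq A2.
have [||rho1 [ex1 b1 A1]] := loop_complete (effect (Copy b None) rho) y.
- by rewrite /= eqxx.
- by rewrite /below (agree_args lt_b (A0 rho)).
have A01 := agree_trans (A0 rho) A1.
have [|rho2 [ex2 val2 A2]] := completef rho1 0.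
  by rewrite args_cons b1 (agree_args lt_b A01).
exists rho2; split.
- exists (effect (Copy b None) rho) => //; exists rho1 => //; exists rho2 => //=.
  by rewrite val2.
- by rewrite A2.
by apply: agree_trans A01 _; apply: agree_leq A2.
Qed.

(** During the loop, [b] counts the iterations done, [b.+1] holds the current value of the
    recursion, and [b.+2] the number of iterations left. *)
Lemma correct_prec n (f : recfun n) (g : recfun n.+2) :
  correct f -> correct g -> correct (RPrec f g).
Proof.
move=> Hf Hg ins b; case/tupleP: ins => x0 ins lt_b0.
have /andP[lt_x0 lt_b] : (x0 < b) && all (ltn^~ b) ins by [].
have [soundf completef] := Hf ins b.+2 (all_ltnW (leqW (leqnSn b)) lt_b).
have lt_b3 : all (ltn^~ b.+3) [tuple of [:: b, b.+1 & ins]].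
  by rewrite /= (all_ltnW _ lt_b) ?andbT; lia.
have [soundg completeg] := Hg _ _ lt_b3.
rewrite /= in soundg completeg.
pose body := Seq (Seq (Atom (Dec b.+2)) (compile g [:: b, b.+1 & ins] b.+3))
        (Seq (Atom (Copy b.+1 (Some b.+3))) (Atom (Inc b))).
pose init := Seq (Seq (compile f ins b.+2) (Atom (Copy b.+1 (Some b.+2))))
        (Seq (Atom (Copy b None)) (Atom (Copy b.+2 (Some x0)))).
pose G rho x z y := computes g [tuple of x :: z :: args ins rho] y.
have neq : (b == b.+1 = false) * (b == b.+2 = false) * (b.+1 == b = false) *
    (b.+2 == b = false) * (b.+1 == b.+2 = false) * (b.+2 == b.+1 = false) *
    (b.+3 == b.+2 = false).
  by do !split; apply/eqP; lia.
have argsG rho : args [tuple of [:: b, b.+1 & ins]] (effect (Dec b.+2) rho) =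
    [tuple of rho b :: rho b.+1 :: args ins rho].
  apply: val_inj; rewrite /= !neq; congr [:: _, _ & _].
  exact: (congr1 (@tval _ _) (agree_args lt_b
    (agree_effect (a := Dec b.+2) rho (leqW (leqnSn b))))).
have body_sound rho rho' : exec body rho rho' -> [/\ rho' b = (rho b).+1,
    (rho' b.+2).+1 = rho b.+2, agree b rho rho' & G rho (rho b) (rho b.+1) (rho' b.+1)].
  case=> rho2 [_ [/= pos ->]] /soundg[]; rewrite argsG => val2 A2 [_ [_ ->] [_ ->]]; split.
  - by lookup; rewrite A2; last lia; lookup.
  - by lookup; rewrite A2; last lia; lookup; rewrite /= prednK.
  - by move=> x ltx; lookup; rewrite A2; last lia; lookup.
  by rewrite /= !neq eqxx.
have body_complete rho y : 0 < rho b.+2 -> G rho (rho b) (rho b.+1) y ->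
    exists rho', [/\ exec body rho rho', rho' b = (rho b).+1,
      (rho' b.+2).+1 = rho b.+2, rho' b.+1 = y & agree b rho rho'].
  move=> pos Gy; have [|rho2 [ex2 val2 A2]] := completeg (effect (Dec b.+2) rho) y.
    by rewrite argsG.
  exists (effect (Inc b) (effect (Copy b.+1 (Some b.+3)) rho2)); split.
  - exists rho2; first by exists (effect (Dec b.+2) rho).
    by exists (effect (Copy b.+1 (Some b.+3)) rho2).
  - by lookup; rewrite A2; last lia; lookup.
  - by lookup; rewrite A2; last lia; lookup; rewrite /= prednK.
  - by rewrite /= !neq eqxx.
  by move=> x ltx; lookup; rewrite A2; last lia; lookup.
have init_sound rho rho' : exec init rho rho' -> [/\ rho' b = 0, rho' b.+2 = rho x0,
    agree b rho rho' & computes f (args ins rho) (rho' b.+1)].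
  case=> _ [rho1 /soundf[val1 A1] [_ ->]] [_ [_ ->] [_ ->]]; split.
  - by rewrite /= neq eqxx.
  - by lookup; rewrite A1 //; lia.
  - by move=> x ltx; lookup; rewrite A1 //; lia.
  by rewrite /= !neq eqxx.
have init_complete rho y : computes f (args ins rho) y -> exists rho',
    [/\ exec init rho rho', rho' b = 0, rho' b.+2 = rho x0, rho' b.+1 = y & agree b rho rho'].
  case/completef => rho1 [ex1 val1 A1].
  exists (effect (Copy b.+2 (Some x0)) (effect (Copy b None)
    (effect (Copy b.+1 (Some b.+2)) rho1))); split.
  - exists (effect (Copy b.+1 (Some b.+2)) rho1); first by exists rho1.
    by exists (effect (Copy b None) (effect (Copy b.+1 (Some b.+2)) rho1)).
  - by rewrite /= neq eqxx.
  - by lookup; rewrite A1 //; lia.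
  - by rewrite /= !neq eqxx.
  by move=> x ltx; lookup; rewrite A1 //; lia.
pose P rho := prec_graph (computes f) (computes g) ^~ (args ins rho).
have loop_sound rho rho' : star (exec body) rho rho' -> P rho (rho b) (rho b.+1) ->
    [/\ P rho (rho' b) (rho' b.+1), rho' b + rho' b.+2 = rho b + rho b.+2 & agree b rho rho'].
  elim=> {rho rho'} [//|rho rho1 rho' /body_sound[b1 b2 A1 Gy] _ IH Prho].
  move: IH; rewrite /P (agree_args lt_b A1) b1 => -[|Prho' sum A'].
    by exists (rho b.+1).
  split=> //; first by rewrite sum; lia.
  exact: agree_trans A1 A'.
(* The base value [y0] comes first because it must be in [b.+1] before the loop starts. The
   inequality [j <= rho0 b.+2] allows stopping after [j] iterations, as the induction on [j]
   requires. *)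
have loop_complete rho j y : P rho j y -> exists2 y0, computes f (args ins rho) y0 &
    forall rho0, agree b rho rho0 -> rho0 b = 0 -> rho0 b.+1 = y0 -> j <= rho0 b.+2 ->
    exists rho', [/\ star (exec body) rho0 rho', rho' b = j, rho' b.+2 = rho0 b.+2 - j,
      rho' b.+1 = y & agree b rho0 rho'].
  elim: j y => [|j IH] y /=.
    move=> fy; exists y => // rho0 _ b0 b1 _; exists rho0; rewrite subn0.
    by split=> //; apply: StarRefl.
  case=> z /IH[y0 fy0 {}IH] gy; exists y0 => // rho0 A0 b0 b1 lt_j.
  have [rho1 [ex1 b01 b21 b11 A1]] := IH rho0 A0 b0 b1 (ltnW lt_j).
  have [||rho2 [ex2 b02 b22 b12 A2]] := body_complete rho1 y.
  - by rewrite b21; lia.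
  - by rewrite /G b01 b11 (agree_args lt_b A1) (agree_args lt_b A0).
  exists rho2; split=> //; try lia.
    by apply: star_trans ex1 (StarStep ex2 (StarRefl _ _)).
  exact: agree_trans A1 A2.
have argsE rho : [tuple of behead (args [tuple of x0 :: ins] rho)] = args ins rho.
  exact: val_inj.
have theadE0 rho : thead (args [tuple of x0 :: ins] rho) = rho x0 by [].
split=> [rho rho'|rho y]; rewrite /= argsE theadE0.
  case=> rho1 /init_sound[b0 b2 A1 fy] [rho2 /loop_sound].
  rewrite /P b0 (agree_args lt_b A1) => -[//|P2 sum A2] [_ [/= /eqP z0 ->] [_ ->]] /=.
  rewrite eqxx; split; first by rewrite -b2 -[rho1 b.+2]add0n -sum z0 addn0.
  apply: (agree_trans _ (agree_effect (a := Copy b (Some b.+1)) _ (leqnn b))).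
  exact: agree_trans A1 A2.
case/loop_complete => y0 /init_complete[rho1 [ex1 b0 b2 b1 A1]].
case/(_ rho1 A1 b0 b1) => [|rho2 [ex2 b02 b22 b12 A2]]; first by rewrite b2.
exists (effect (Copy b (Some b.+1)) rho2); split.
- exists rho1 => //; exists rho2 => //; exists rho2 => //; split=> //=.
  by rewrite b22 b2 subnn.
- by rewrite /= eqxx.
apply: (agree_trans _ (agree_effect (a := Copy b (Some b.+1)) _ (leqnn b))).
exact: agree_trans A1 A2.
Qed.

Lemma compile_correct n (f : recfun n) : correct f.
Proof.
elim: f => {n} [n||n i|k n f Hf g Hg|n f Hf g Hg|n f Hf].
- move=> ins b lt_b; split=> [rho rho' [_ ->]|rho _ /= ->].
    by split; [rewrite /= eqxx | apply: agree_effect].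
  by exists (effect (Copy b None) rho); split; [|rewrite /= eqxx|apply: agree_effect].
- move=> ins b; case/tupleP: ins => x ins lt_b.
  have AA rho : agree b rho (effect (Inc b) (effect (Copy b (Some x)) rho)).
    by move=> y lt_y; lookup.
  split=> [rho rho' [_ [_ ->] [_ ->]]|rho _ /= ->].
    by split; [rewrite /= !eqxx | apply: AA].
  eexists; split; last exact: AA.
    by exists (effect (Copy b (Some x)) rho).
  by rewrite /= !eqxx.
- move=> ins b lt_b; split=> [rho rho' [_ ->]|rho _ /= ->].
    by split; [rewrite /= eqxx tnth_map (tnth_nth 0) | apply: agree_effect].
  exists (effect (Copy b (Some (nth 0 ins i))) rho); split=> //; last exact: agree_effect.
  by rewrite /= eqxx tnth_map (tnth_nth 0).
- exact: correct_comp.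
- exact: correct_prec.
exact: correct_mu.
Qed.

(** * Tilings as solutions of a tree equation *)

Section Equation.
Variables (S : eqType) (E : seq (S * atom * S)) (q0 qf : S).

Notation tile := (tile E q0 qf).
Notation vcolor := (vcolor E q0 qf).
Notation hcolor := (hcolor E).
Notation state_color := (@state_color S E q0 qf).

Definition symbol : finType := (tile + (vcolor + hcolor))%type.

Definition tsym (z : tile) : symbol := inl z.
Definition vsym (c : vcolor) : symbol := inr (inl c).
Definition hsym (c : hcolor) : symbol := inr (inr c).

Definition vproj (a : symbol) : vcolor := if a is inr (inl c) then c else state_color q0.
Definition hproj (a : symbol) : hcolor := if a is inr (inr c) then c else None.

Lemma vsymK : cancel vsym vproj. Proof. by []. Qed.
Lemma hsymK : cancel hsym hproj. Proof. by []. Qed.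

(** Keeping the colors fixed makes the projections of tiles to colors idempotent, as [recode_eword]
    demands. *)
Definition tile_map (f : tile -> symbol) (a : symbol) : symbol :=
  if a is inl z then f z else a.

Definition blank : column E := nseq_tuple (width E) false.
Definition unit_column : column E := set_bit 0 true blank.

(** Sending every tile to this one turns a word of tiles into a power of one letter. Conversely,
    since this tile is valid itself, an equation requiring such a power forces the unknown to be a
    word of valid tiles. *)
Definition copy_tile : tile := (inr blank, inr blank, None, None).

Definition tiles : seq symbol := [seq tsym z | z <- enum (tile : finType) & is_tile z].

Definition to_top := tile_map (vsym \o @top _ _ _ _).
Definition to_bot := tile_map (vsym \o @bot _ _ _ _).
Definition to_left := tile_map (hsym \o @left _ _ _ _).
Definition to_right := tile_map (hsym \o @right _ _ _ _).
Definition to_copy : symbol -> symbol := tile_map (fun => tsym copy_tile).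

Lemma tile_map_idem (f : tile -> symbol) : (forall z a, f z = tsym a -> f a = tsym a) ->
  forall a, tile_map f (tile_map f a) = tile_map f a.
Proof. by move=> ff [z|c] //=; case Ez: (f z) => [a|c] //=; apply: (ff _ _ Ez). Qed.

Notation lt a := (letter (Some (a : symbol))).
Notation eps := (letter (None : option symbol)).

(* The values of [p], [x] and [z] are the unused columns of the first row, the
   columns holding the input, and the word of tiles. *)
Definition solves (n : nat) (p z u x d : tree) : Prop :=
  [/\ tree_subst p eps (Node (lt (vsym (inr blank))) eps) = Node (lt (vsym (inr blank))) p,
      tree_subst x eps (Node (lt (vsym (inr unit_column))) eps) =
        Node (lt (vsym (inr unit_column))) x,
      tree_subst (recode to_copy tiles z) eps (Node (lt (tsym copy_tile)) eps) =
        Node (lt (tsym copy_tile)) (recode to_copy tiles z),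
      tree_subst (recode to_top tiles z) eps (Node (lt (vsym (state_color qf))) u) =
        Node (lt (vsym (state_color q0)))
          (tree_subst x eps (tree_subst p eps (recode to_bot tiles z))) &
      tree_subst (recode to_left tiles z) eps (Node d eps) = Node d (recode to_right tiles z) /\
      tree_subst (tree_subst x (lt (vsym (inr unit_column))) Leaf) eps Leaf = numeral n].

Lemma subset_tiles (w : seq symbol) : {subset w <= tiles} ->
  exists2 Z, w = map tsym Z & all (@is_tile _ _ _ _) Z.
Proof.
elim: w => [|a w IH] sub; first by exists [::].
have [|Z -> TZ] := IH; first by move=> b bw; apply: sub; rewrite inE bw orbT.
have /mapP[z] := sub a (mem_head _ _).
by rewrite mem_filter => /andP[Tz _] ->; exists (z :: Z); rewrite //= Tz.
Qed.

Lemma tiles_subset Z : all (@is_tile _ _ _ _) Z -> {subset map tsym Z <= tiles}.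
Proof.
move=> /allP TZ a /mapP[z /TZ Tz ->]; apply: map_f.
by rewrite mem_filter Tz mem_enum.
Qed.

Lemma recode_tiles (f : tile -> symbol) Z : (forall z a, f z = tsym a -> f a = tsym a) ->
  all (@is_tile _ _ _ _) Z ->
  recode (tile_map f) tiles (eword (map tsym Z)) = eword (map f Z).
Proof.
move=> /tile_map_idem ff TZ; rewrite recode_eword //; last exact: tiles_subset.
by rewrite -map_comp.
Qed.

Definition input (n : nat) : nat -> nat := fun x => if x == 0 then n else 0.

Lemma value_input n j : value (nseq n unit_column ++ nseq j blank) = input n.
Proof.
apply: functional_extensionality => x; rewrite /value count_cat !count_nseq.
have blank_x : bit blank x = false by rewrite /bit nth_nseq if_same.
rewrite blank_x /input; case: eqP => [->|/eqP ne]; first by rewrite bit_set // mul1n addn0.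
by rewrite -(same_butP (same_but_set 0 true blank) ne) blank_x.
Qed.

Lemma copy_tileP : is_tile copy_tile.
Proof. by rewrite /is_tile /= eqxx. Qed.

Lemma solves_picture n p z u x d : solves n p z u x d ->
  exists j Z w c, is_picture q0 (nseq n unit_column ++ nseq j blank) Z w /\ @chain S E q0 qf c Z c.
Proof.
case=> /commute_eword_inv[j ->] /commute_eword_inv[m ->] /commute_eword_inv[l].
case/recode_inv => v -> sub_v.
have {sub_v}/subset_tiles [Z -> TZ] : {subset v <= tiles}.
  move=> a /sub_v; rewrite mem_cat => /orP[//|/nseqP[-> _]].
  by apply: map_f; rewrite mem_filter copy_tileP mem_enum.
rewrite !recode_tiles // => Etop [Eside]; rewrite subst_numeral => /numeral_inj Em; subst m.
exists j, Z.
have [w Ew] : exists w, map (@top _ _ _ _) Z ++ state_color qf :: w =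
    state_color q0 :: map inr (nseq n unit_column ++ nseq j blank) ++ map (@bot _ _ _ _) Z.
  move: Etop; rewrite !subst_end -!word_cat.
  (* A priori [u] is any tree, but as the tail of a word it is a word [w]; [vproj] then reads its
     letters as colors. *)
  rewrite word_cons => /word_eword_inv[[/letter_Node_inv //|a w] /Node_inj[/letter_inj[<-] _]].
  move=> Ew; exists (map vproj w); rewrite -[RHS](mapK vsymK).
  have -> : map vsym (state_color q0 :: map inr (nseq n unit_column ++ nseq j blank) ++
      map (@bot _ _ _ _) Z) = map (vsym \o @top _ _ _ _) Z ++ vsym (state_color qf) :: w.
    by rewrite /= !map_cat !map_nseq -!map_comp; exact: Ew.
  by rewrite map_cat -map_comp.
(* With no tiles, the side equation says nothing about [d], and any color closes the chain.
   Otherwise the first letter on the left-hand side shows that [d] is a color. *)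
case: Z TZ Eside Ew {Etop} => [|z1 Z] TZ Eside Ew; first by exists w, None.
move: Eside; rewrite subst_end => Eside.
have Ed : d = lt (hsym (left z1)) by case/Node_inj: Eside.
move: Eside; rewrite Ed (word_cons _ [::]) -word_cat word_cons => /eword_inj.
rewrite cats1 => Eside; exists w, (left z1); split=> //; apply/chainP.
apply: (can_inj (mapK hsymK)); rewrite map_rcons -map_comp; symmetry.
rewrite [in RHS]/= -map_comp; exact: Eside.
Qed.

Lemma picture_solves n j Z w c :
    is_picture q0 (nseq n unit_column ++ nseq j blank) Z w -> @chain S E q0 qf c Z c ->
  exists p z u x d, solves n p z u x d.
Proof.
case=> TZ EZ /chainP Ec.
exists (eword (nseq j (vsym (inr blank)))), (eword (map tsym Z)), (eword (map vsym w)),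
  (eword (nseq n (vsym (inr unit_column)))), (lt (hsym c)).
have comm a k : word (nseq k a) (Node (lt a) eps) = Node (lt a) (eword (nseq k a)).
  by rewrite (word_cons _ [::]) -word_cat word_cons -(nseqD k 1 a) addn1.
split; rewrite ?subst_end ?comm ?recode_tiles //.
- rewrite (_ : map _ _ = nseq (size Z) (tsym copy_tile)) ?subst_end ?comm //.
  by elim: (Z) => //= ? ? ->.
- rewrite !subst_end -!word_cat.
  rewrite !word_cons -word_cat; congr word; move/(congr1 (map vsym)): EZ.
  by rewrite /= !map_cat /= -!map_comp !map_nseq -!catA.
split; last exact: subst_numeral.
rewrite subst_end (word_cons _ [::]) -word_cat word_cons cats1.
move/(congr1 (map hsym)): Ec; rewrite /= map_rcons -!map_comp => Ec.
exact: (congr1 (@eword symbol) (esym Ec)).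
Qed.

(** Blank columns do not change the registers, so [p] can supply as much space as the run needs. *)
Lemma solves_reach n :
  (exists p z u x d, solves n p z u x d) <-> exists rho, reach E q0 (input n) qf rho.
Proof.
split=> [[p [z [u [x [d /solves_picture[j [Z [w [c [pic ch]]]]]]]]]]|R].
  by have := picture_reach pic ch; rewrite value_input.
have [||j [Z [w [c [pic ch]]]]] := @reach_picture _ E q0 qf (input n)
  (fun j => nseq n unit_column ++ nseq j blank) _ _ R.
- by move=> j; rewrite size_cat !size_nseq leq_addl.
- by move=> j; apply: value_input.
exact: picture_solves pic ch.
Qed.
End Equation.

(** * Diagonalization *)

Lemma computes_functional n (f : recfun n) v y y' :
  computes f v y -> computes f v y' -> y = y'.
Proof.
elim: f v y y' => {n} [n||n i|k n f IHf g IHg|n f IHf g IHg|n f IHf] v y y' /=.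
- by move=> -> ->.
- by move=> -> ->.
- by move=> -> ->.
- case=> w Hw fy [w' Hw' fy']; suff E : w = w' by apply: IHf fy _; rewrite E.
  by apply: eq_from_tnth => i; apply: IHg (Hw i) (Hw' i).
- elim: (thead v) y y' => [|x IH] y y' /=; first exact: IHf.
  by case=> z /IH Ez gy [z' /Ez <-]; apply: IHg.
case=> fy bel [fy' bel']; case: (ltngtP y y') => // [/bel'|/bel] [u fu].
  by have := IHf _ _ _ fy fu.
by have := IHf _ _ _ fy' fu.
Qed.

Definition computable n (F : n.-tuple nat -> nat) : Prop :=
  exists f : recfun n, forall v, computes f v (F v).

Lemma computable_ext n (F G : n.-tuple nat -> nat) : F =1 G -> computable F -> computable G.
Proof. by move=> FG [f Hf]; exists f => v; rewrite -FG. Qed.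

Lemma computable_arg n (i : 'I_n) : computable (fun v => tnth v i).
Proof. by exists (RProj i). Qed.

Lemma computable_comp1 n (H : 1.-tuple nat -> nat) (F : n.-tuple nat -> nat) :
  computable H -> computable F -> computable (fun v => H [tuple F v]).
Proof.
move=> [h Hh] [f Hf]; exists (RComp h (fun=> f)) => v.
by exists [tuple F v] => // i; rewrite ord1.
Qed.

Lemma computable_comp2 n (H : 2.-tuple nat -> nat) (F G : n.-tuple nat -> nat) :
  computable H -> computable F -> computable G ->
  computable (fun v => H [tuple F v; G v]).
Proof.
move=> [h Hh] [f Hf] [g Hg]; exists (RComp h (tnth [tuple f; g])) => v.
by exists [tuple F v; G v] => //; case=> [[|[|]]].
Qed.

Lemma computable_succ n (F : n.-tuple nat -> nat) :
  computable F -> computable (fun v => (F v).+1).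
Proof. by apply: (@computable_comp1 n (fun v => (thead v).+1)); exists RSucc. Qed.

Lemma computable_const n c : computable (fun _ : n.-tuple nat => c).
Proof. by elim: c => [|c IH]; [exists (RZero n) | apply: computable_succ]. Qed.

Lemma computable_rec (c : nat) (H : nat -> nat -> nat) :
  computable (fun v : 2.-tuple nat => H (tnth v ord0) (tnth v ord_max)) ->
  computable (fun v : 1.-tuple nat => nat_rec (fun=> nat) c H (tnth v ord0)).
Proof.
have [f Hf] := computable_const 0 c; case=> h Hh.
exists (RPrec f h) => v.
change (prec_graph (computes f) (computes h) (tnth v ord0) [tuple of behead v]
  (nat_rec (fun=> nat) c H (tnth v ord0))).
elim: (tnth v ord0) => [|x IH] /=; first exact: Hf.
by exists (nat_rec (fun=> nat) c H x); rewrite //; exact: Hh.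
Qed.

Lemma computable_add n (F G : n.-tuple nat -> nat) :
  computable F -> computable G -> computable (fun v => F v + G v).
Proof.
apply: (@computable_comp2 n (fun v => tnth v ord0 + tnth v ord_max)).
have [s Hs] := computable_succ (@computable_arg 3 (@Ordinal 3 1 isT)).
exists (RPrec (RProj ord0) s) => v.
change (prec_graph (computes (@RProj 1 ord0)) (computes s) (tnth v ord0) [tuple of behead v]
  (tnth v ord0 + tnth v ord_max)).
elim: (tnth v ord0) => [|x IH] /=.
  by rewrite add0n tnth_behead; congr (tnth v _); apply: val_inj; rewrite /= inordK.
by exists (x + tnth v ord_max); rewrite //; exact: Hs.
Qed.

Lemma computable_pcode n (F G : n.-tuple nat -> nat) :
  computable F -> computable G -> computable (fun v => pcode (F v) (G v)).
Proof.
move=> HF HG; rewrite /pcode /Cantor.to_nat.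
(* Cantor pairing adds to its second argument the triangular number of the sum of both, which is a
   primitive recursion. *)
apply: (@computable_ext _ (fun v =>
    G v + nat_rec (fun=> nat) 0 (fun i m => i.+1 + m) (G v + F v))) => //.
apply: computable_add => //.
apply: (@computable_comp1 n (fun v => nat_rec (fun=> nat) 0 (fun i m => i.+1 + m) (tnth v ord0))).
  apply: computable_rec; apply: computable_add; last exact: computable_arg.
  exact/computable_succ/computable_arg.
exact: computable_add.
Qed.

(** * Writing the tree equations as terms *)

Fixpoint tree_term (t : tree) : term :=
  if t is Node t1 t2 then Pair (tree_term t1) (tree_term t2) else Bot.

Lemma eval_tree_term e t : eval e (tree_term t) = t.
Proof. by elim: t => //= t1 -> t2 ->. Qed.

Lemma term_vars_tree_term t : term_vars (tree_term t) = [::].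
Proof. by elim: t => //= t1 -> t2 ->. Qed.

Definition recode_term (A : finType) (f : A -> A) (s : seq A) (t : term) : term :=
  foldl (fun t a => Subst t (tree_term (letter (Some a))) (tree_term (letter (Some (f a))))) t s.

Lemma eval_recode_term (A : finType) (f : A -> A) s t e :
  eval e (recode_term f s t) = recode f s (eval e t).
Proof. by elim: s t => //= a s IH t; rewrite IH /= !eval_tree_term. Qed.

Lemma vars_recode_term (A : finType) (f : A -> A) s t :
  term_vars (recode_term f s t) = term_vars t.
Proof.
elim: s t => [|a s IH] t //.
by rewrite [LHS]IH [LHS]/= !term_vars_tree_term !cats0.
Qed.

Definition below (k : nat) (t : term) : bool := all (ltn^~ k) (term_vars t).

Lemma below_Pair k s t : below k (Pair s t) = below k s && below k t.
Proof. exact: all_cat. Qed.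

Lemma below_Subst k t r s :
  below k (Subst t r s) = [&& below k t, below k r & below k s].
Proof. by rewrite /below /= !all_cat. Qed.

Lemma below_tree_term k t : below k (tree_term t).
Proof. by rewrite /below term_vars_tree_term. Qed.

Lemma below_recode_term k (A : finType) (f : A -> A) s t :
  below k (recode_term f s t) = below k t.
Proof. by rewrite /below vars_recode_term. Qed.

Lemma eq_eval k t e e' : below k t -> (forall x, x < k -> e x = e' x) -> eval e t = eval e' t.
Proof.
move=> + ee'; elim: t => [x||s IHs t IHt|t IHt r IHr s IHs] //.
- by rewrite /below /= andbT => /ee'.
- by rewrite below_Pair => /andP[/IHs + /IHt] => /= -> ->.
by rewrite below_Subst => /and3P[/IHt + /IHr + /IHs] => /= -> -> ->.
Qed.

Lemma eval_Pair e s t : eval e (Pair s t) = Node (eval e s) (eval e t).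
Proof. by []. Qed.

Lemma eval_Subst e t r s : eval e (Subst t r s) = tree_subst (eval e t) (eval e r) (eval e s).
Proof. by []. Qed.

Lemma eval_Var e x : eval e (Var x) = e x.
Proof. by []. Qed.

(* The trees [p], [z], [u], [x], [d] of [solves] are the values of the variables
   0 to 4. *)
Section Terms.
Variables (S : eqType) (E : seq (S * atom * S)) (q0 qf : S).

Notation symbol := (symbol E q0 qf).
Notation sym a := (tree_term (letter (Some (a : symbol)))).
Notation eps := (tree_term (letter (None : option symbol))).
Notation blank := (sym (vsym (inr (blank E)))).
Notation unit := (sym (vsym (inr (unit_column E)))).
Notation copy := (sym (tsym (copy_tile E q0 qf))).
Notation state q := (sym (vsym (state_color _ _ _ q))).
Notation recoded f := (recode_term (f : symbol -> symbol) (tiles E q0 qf) (Var 1)).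

Definition left_term : term :=
  Pair (Pair (Pair (Subst (Var 0) eps (Pair blank eps)) (Subst (Var 3) eps (Pair unit eps)))
    (Pair (Subst (recoded (@to_copy _ _ _ _)) eps (Pair copy eps))
      (Subst (recoded (@to_top _ _ _ _)) eps (Pair (state qf) (Var 2)))))
  (Subst (recoded (@to_left _ _ _ _)) eps (Pair (Var 4) eps)).

Definition right_term : term :=
  Pair (Pair (Pair (Pair blank (Var 0)) (Pair unit (Var 3)))
    (Pair (Pair copy (recoded (@to_copy _ _ _ _)))
      (Pair (state q0) (Subst (Var 3) eps (Subst (Var 0) eps (recoded (@to_bot _ _ _ _)))))))
  (Pair (Var 4) (recoded (@to_right _ _ _ _))).

Definition input_term : term := Subst (Subst (Var 3) unit Bot) eps Bot.

(** Equated with a pair of [Pair v v] and a numeral, for a fresh variable [v], this term expresses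
    all the equations of [solves] at once. The input thus occurs only on the other side, and
    [machine_term] does not depend on it. *)
Definition machine_term : term := Pair (Pair left_term right_term) input_term.

Let belowE := (below_Pair, below_Subst, below_tree_term, below_recode_term).

Lemma below_left_term : below 5 left_term.
Proof. by rewrite /left_term !belowE. Qed.

Lemma below_machine_term : below 6 machine_term.
Proof. by rewrite /machine_term /left_term /right_term /input_term !belowE. Qed.

Lemma eval_machine_term e n t :
  eval e machine_term = Node (Node t t) (numeral n) <->
  eval e left_term = t /\ @solves _ E q0 qf n (e 0) (e 1) (e 2) (e 3) (e 4).
Proof.
rewrite /machine_term /left_term /right_term /input_term.
rewrite !(eval_Pair, eval_Subst, eval_Var, eval_recode_term, eval_tree_term).
split; last by case=> <- [-> -> -> -> [-> ->]].
case/Node_inj=> /Node_inj[<- E1] E6.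
move/esym: E1 => /Node_inj[/Node_inj[/Node_inj[E1 E2] /Node_inj[E3 E4]] E5].
by split=> //; split.
Qed.
End Terms.

(** * The diagonal sentence *)

Definition sentence (t : term) (n : nat) : formula :=
  Ex 0 (Ex 1 (Ex 2 (Ex 3 (Ex 4 (Ex 5
    (Eq t (Pair (Pair (Var 5) (Var 5)) (tree_term (numeral n))))))))).

Lemma sentence_closed t n : below 6 t -> is_sentence (sentence t n).
Proof.
rewrite /is_sentence /below /= term_vars_tree_term;
elim: (term_vars t) => //= x s IH /andP[lt_x lt_s].
by case: x lt_x => [|[|[|[|[|[|]]]]]] //= _; apply: IH.
Qed.

Fixpoint numeral_code (n : nat) : nat :=
  if n is m.+1 then pcode 2 (pcode (pcode 1 0) (numeral_code m)) else pcode 1 0.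

Lemma numeral_codeE n : term_code (tree_term (numeral n)) = numeral_code n.
Proof. by elim: n => //= n ->. Qed.

(** When [n] is the code of a term, this is the code of the sentence that applies the term to its
    own code; the term enters only through [n]. *)
Definition diagonal_code (n : nat) : nat :=
  pcode 1 (pcode 0 (pcode 1 (pcode 1 (pcode 1 (pcode 2 (pcode 1 (pcode 3 (pcode 1 (pcode 4
  (pcode 1 (pcode 5 (pcode 0 (pcode n (pcode 2 (pcode (pcode 2 (pcode (pcode 0 5) (pcode 0 5)))
    (numeral_code n)))))))))))))))).

Lemma diagonal_codeE t : formula_code (sentence t (term_code t)) = diagonal_code (term_code t).
Proof. by rewrite /diagonal_code /= numeral_codeE. Qed.

Lemma computable_diagonal_code : computable (fun v : 1.-tuple nat => diagonal_code (tnth v ord0)).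
Proof.
have num : computable (fun v : 1.-tuple nat => numeral_code (tnth v ord0)).
  apply: (@computable_ext _ (fun v => nat_rec (fun=> nat) (pcode 1 0)
    (fun _ m => pcode 2 (pcode (pcode 1 0) m)) (tnth v ord0))).
    by move=> v /=; elim: (tnth v ord0) => //= n ->.
  apply: computable_rec; do ![apply: computable_pcode | apply: computable_const].
  exact: computable_arg.
rewrite /diagonal_code.
by do ![apply: computable_pcode | apply: computable_const | exact: num | exact: computable_arg].
Qed.

Definition acceptor (h : recfun 1) : prog := Seq (compile h [:: 0] 1) (Atom (Zero 1)).

Lemma acceptorP h n :
  (exists rho, reach (trans (acceptor h) [::]) [:: acceptor h] (input n) [::] rho) <->
  computes h [tuple n] 0.
Proof.
have [sound complete] := @compile_correct _ h [tuple 0] 1 isT.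
have E0 : args [tuple 0] (input n) = [tuple n] by apply: val_inj.
split=> [[rho /reach_exec[rho1 /sound[]]]|h0].
  by rewrite E0 => hy _ [/eqP z0 _]; rewrite z0 in hy.
have [|rho [ex val _]] := complete (input n) 0; first by rewrite E0.
exists rho; apply: exec_reach => //; exists rho => //=.
by rewrite val.
Qed.

Definition halting_term (h : recfun 1) : term :=
  machine_term (trans (acceptor h) [::]) [:: acceptor h] [::].

Lemma Th_H10_sentence h n : Th_H10 (sentence (halting_term h) n) <-> computes h [tuple n] 0.
Proof.
rewrite -acceptorP -solves_reach; split.
  case=> _ /(_ (fun=> Leaf)) [p [z [u [x [d [t]]]]]].
  rewrite /sat [in RHS]/= eval_tree_term => /eval_machine_term[_ sol].
  by exists p, z, u, x, d.
case=> p [z [u [x [d sol]]]]; split=> [|rho]; first exact/sentence_closed/below_machine_term.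
exists p, z, u, x, d.
pose e : nat -> tree := nth Leaf [:: p; z; u; x; d].
(* Variable 5 receives the common value of the two sides; it does not occur in [left_term], so
   assigning it leaves that value unchanged. *)
pose t := eval e (left_term (trans (acceptor h) [::]) [:: acceptor h] [::]).
exists t; rewrite /sat; set e' := [eta _ with 5 |-> t].
rewrite [RHS]/= eval_tree_term; apply/eval_machine_term; split=> //.
apply: eq_eval (below_left_term _ _ _) _.
by do 5![case=> //].
Qed.

Theorem theorem6 : ~ decidable_formula_set Th_H10.
Proof.
case=> chi chiP [f Hf].
have [h Hh] : computable (fun v : 1.-tuple nat => chi (diagonal_code (tnth v ord0)) : nat).
  apply: (@computable_comp1 1 (fun v => chi (tnth v ord0) : nat)).
    exists f => v; case/tupleP: v => m v; rewrite tuple0.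
    exact: Hf.
  exact: computable_diagonal_code.
(* The sentence at the code [n] of its own term is true exactly when [h] returns 0 at [n], that is,
   when [chi] rejects this very sentence. *)
pose t := halting_term h; pose n := term_code t.
have := Th_H10_sentence h n; have := Hh [tuple n]; rewrite [tnth _ _]/=.
have -> : Th_H10 (sentence (halting_term h) n) <-> chi (diagonal_code n).
  rewrite -chiP -diagonal_codeE; split=> [Th|[phi Th /formula_code_inj <-]] //.
  by exists (sentence t n).
case: (chi _) => hn [].
  by move=> /(_ isT) /(computes_functional hn).
by move=> _ /(_ hn).
Qed.
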